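(* Let $U^2=\sup_{u,w\in\mathcal W}\big(\psi(u)-\psi(w)\big)<\infty$ and $G^2=\sup_{w\in\mathcal W}\mathbb E_{(x,y)\sim\mathbb P}\|g(x,y,w)\|_*^2<\infty$, where $g(x,y,w)\in\partial_w\ell(x,y,w)$ is the subgradient selection used by the algorithm. Let $n\ge 1$, let $\alpha_1,\dots,\alpha_n>0$ be deterministic step sizes, let $w^1,\dots,w^n$ be the stochastic mirror descent iterates described in the context, computed from an i.i.d. sample $(x_1,y_1),\dots,(x_n,y_n)\sim\mathbb P$, and let $$w^{(n)}=\frac{\sum_{m=1}^n\alpha_m w^m}{\sum_{m=1}^n\alpha_m}.$$ Then for every (deterministic) $w\in\mathcal W$, $$\mathbb E\big(\ell(x,y,w^{(n)})-\ell(x,y,w)\big)\le\frac{U^2+\frac{G^2}{2}\sum_{m=1}^n\alpha_m^2}{\sum_{m=1}^n\alpha_m},$$ where the expectation is over the sample and over an independent pair $(x,y)\sim\mathbb P$; equivalently, $\mathbb E\,F(w^{(n)})-F(w)$ is bounded by the right-hand side.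
   Context: Multi-class classification setting. Let $d\ge1$, $k\ge 2$, $\mathcal X\subseteq\mathbb R^d$ (instances), $\mathcal Y=\{1,\dots,k\}$ (classes), and let $\mathbb P$ be a probability distribution on $\mathcal X\times\mathcal Y$. Let $E=\mathbb R^{d\times k}$, with elements $w=(w_1,\dots,w_k)$, $w_y\in\mathbb R^d$, with the standard inner product $\langle\cdot,\cdot\rangle$, equipped with a norm $\|\cdot\|$ (not necessarily the Euclidean one) whose dual norm is $\|g\|_*=\sup_{\|w\|\le1}\langle g,w\rangle$. Let $\mathcal W\subseteq E$ be a nonempty closed convex set. Decision functions are linear: $f(x,y,w)=\langle x,w_y\rangle$. The margin is $m(x,y,w)=f(x,y,w)-\max_{\hat y\in\mathcal Y,\ \hat y\ne y}f(x,\hat y,w)$. For a fixed $\rho>0$ the loss is $\ell(x,y,w)=\max\{0,\,1-m(x,y,w)/\rho\}$, which is convex in $w$. The expected risk is $F(w)=\mathbb E_{(x,y)\sim\mathbb P}\,\ell(x,y,w)$, assumed finite for all $w\in\mathcal W$. The set $\partial_w\ell(x,y,w)$ is the convex subdifferential of $\ell(x,y,\cdot)$ at $w$, and $g$ is a fixed measurable map with $g(x,y,w)\in\partial_w\ell(x,y,w)$ for all $(x,y,w)\in\mathcal X\times\mathcal Y\times\mathcal W$. The function $\psi:E\to\mathbb R$ is differentiable at the points of $\mathcal W$, with gradient $\nabla\psi$ continuous on $\mathcal W$, and strongly convex with respect to $\|\cdot\|$: $\psi(w^1)-\psi(w^2)-\langle\nabla\psi(w^2),w^1-w^2\rangle\ge\frac12\|w^1-w^2\|^2$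 for all $w^1,w^2\in\mathcal W$. Its Bregman divergence is $\Delta(w^1,w^2)=\psi(w^1)-\psi(w^2)-\langle\nabla\psi(w^2),w^1-w^2\rangle$. Stochastic mirror descent (superscripts on $w$ index iterations): $w^1=\operatorname{arg\,min}_{w\in\mathcal W}\psi(w)$, and for $m\ge1$, with $g^m=g(x_m,y_m,w^m)$, $$w^{m+1}=\operatorname{arg\,min}_{w\in\mathcal W}\{\Delta(w,w^m)+\alpha_m\langle g^m,w-w^m\rangle\}.$$ Thus $w^m$ depends only on $(x_1,y_1),\dots,(x_{m-1},y_{m-1})$ and is independent of $(x_m,y_m)$. *)

(* Defs.v *)
From HB Require Import structures.
From mathcomp Require Import all_boot all_order all_algebra.
From mathcomp Require Import all_classical all_reals all_analysis.

Set Implicit Arguments.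
Unset Strict Implicit.
Unset Printing Implicit Defensive.

Import Order.TTheory GRing.Theory Num.Theory.
Import numFieldNormedType.Exports.

Local Open Scope classical_set_scope.
Local Open Scope ring_scope.

(* Real matrices carry the Borel sigma-algebra of their canonical topology. *)
HB.instance Definition _ (R : realType) (m n : nat) :=
  @isMeasurable.Build (sigma_display (@open 'M[R]_(m, n))) 'M[R]_(m, n)
    <<s @open 'M[R]_(m, n) >>
    (@sigma_algebra0 _ setT (@open 'M[R]_(m, n)))
    (@sigma_algebraC 'M[R]_(m, n) (@open 'M[R]_(m, n)))
    (@sigma_algebra_bigcup _ setT (@open 'M[R]_(m, n))).

(* The subset X of R^d as a type, with the trace of the Borel sigma-algebra.
   Measurable types of the library are pointed, which is why the type depends
   on a proof that X is nonempty (a consequence of the existence of a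
   probability distribution on X x Y). *)
Definition instance (R : realType) (d : nat) (X : set 'cV[R]_d)
  of X !=set0 : Type := set_type X.

Section instance_measurable.
Context (R : realType) (d : nat) (X : set 'cV[R]_d) (X0 : X !=set0).

HB.instance Definition _ := Choice.on (instance X0).
HB.instance Definition _ := isPointed.Build (instance X0)
  (exist (fun x => x \in X) (projT1 (cid X0)) (mem_set (projT2 (cid X0)))).

Definition vec (x : instance X0) : 'cV[R]_d := \val x.

HB.instance Definition _ :=
  Measurable.copy (instance X0) (g_sigma_algebra_preimageType vec).

End instance_measurable.

(* The k classes, with the discrete sigma-algebra; the proof argument again
   provides the point. *)
Definition class (k : nat) of (1 < k)%N : Type := 'I_k.

Section class_measurable.
Context (k : nat) (k1 : (1 < k)%N).

HB.instance Definition _ := Finite.on (class k1).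
HB.instance Definition _ := isPointed.Build (class k1) (Ordinal (ltnW k1)).
HB.instance Definition _ := @isMeasurable.Build default_measure_display
  (class k1) discrete_measurable discrete_measurable0
  discrete_measurableC discrete_measurableU.

End class_measurable.

Section linear_algebra.
Context (R : realType).

Definition inner (m n : nat) (a b : 'M[R]_(m, n)) : R :=
  \sum_i \sum_j a i j * b i j.

Definition is_norm (V : lmodType R) (N : V -> R) : Prop :=
  [/\ forall v, N v = 0 -> v = 0,
      forall u v, N (u + v) <= N u + N v
    & forall (a : R) v, N (a *: v) = `|a| * N v].

Definition dual_norm (m n : nat) (N : 'M[R]_(m, n) -> R) (g : 'M[R]_(m, n)) : R :=
  sup [set inner g w | w in [set w | N w <= 1]].

Definition gradient (m n : nat) (psi : 'M[R]_(m, n) -> R) (w : 'M[R]_(m, n)) :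
    'M[R]_(m, n) :=
  \matrix_(i, j) 'D_(delta_mx i j) psi w.

Definition bregman (m n : nat) (psi : 'M[R]_(m, n) -> R) (u w : 'M[R]_(m, n)) : R :=
  psi u - psi w - inner (gradient psi w) (u - w).

Definition subdifferential (m n : nat) (h : 'M[R]_(m, n) -> R) (w : 'M[R]_(m, n)) :
    set 'M[R]_(m, n) :=
  [set g | forall u, h w + inner g (u - w) <= h u].

Definition is_argmin (T : Type) (W : set T) (h : T -> R) (w : T) : Prop :=
  W w /\ forall u, W u -> h w <= h u.

End linear_algebra.

Section classification.
Context (R : realType) (d k : nat).

Definition score (x : 'cV[R]_d) (y : 'I_k) (w : 'M[R]_(d, k)) : R :=
  inner x (col y w).

(* For k >= 2, the sup ranges over a finite nonempty set: it is the maximum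
   of the scores of the wrong classes. *)
Definition margin (x : 'cV[R]_d) (y : 'I_k) (w : 'M[R]_(d, k)) : R :=
  score x y w - sup [set score x y' w | y' in [set y' | y' != y]].

Definition loss (rho : R) (x : 'cV[R]_d) (y : 'I_k) (w : 'M[R]_(d, k)) : R :=
  Num.max 0 (1 - margin x y w / rho).

Definition risk (X : set 'cV[R]_d) (X0 : X !=set0) (k1 : (1 < k)%N)
    (P : probability (instance X0 * class k1)%type R) (rho : R)
    (w : 'M[R]_(d, k)) : \bar R :=
  (\int[P]_z (loss rho (vec z.1) z.2 w)%:E)%E.

End classification.

(* z 1, z 2, ... are the data and w 1, ..., w n the iterates; the iterate
   w m.+1 is computed from w m and z m. *)
Definition mirror_descent (R : realType) (d k : nat) (T : Type)
    (W : set 'M[R]_(d, k)) (psi : 'M[R]_(d, k) -> R)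
    (g : T -> 'M[R]_(d, k) -> 'M[R]_(d, k)) (alpha : nat -> R) (n : nat)
    (z : nat -> T) (w : nat -> 'M[R]_(d, k)) : Prop :=
  is_argmin W psi (w 1%N) /\
  forall m, (1 <= m < n)%N ->
    is_argmin W
      (fun u => bregman psi u (w m) + alpha m * inner (g (z m) (w m)) (u - w m))
      (w m.+1).

Definition weighted_average (R : realType) (d k : nat) (alpha : nat -> R) (n : nat)
    (w : nat -> 'M[R]_(d, k)) : 'M[R]_(d, k) :=
  (\sum_(1 <= m < n.+1) alpha m)^-1 *: \sum_(1 <= m < n.+1) alpha m *: w m.

Section iid.
Context (R : realType) (dO dT : measure_display)
  (Omega : measurableType dO) (T : measurableType dT) (Pr : probability Omega R).
Local Open Scope ereal_scope.

Definition mutually_independent (I : finType) (Z : I -> {RV Pr >-> T}) : Prop :=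
  forall (J : {set I}) (A : I -> set T), (forall i, measurable (A i)) ->
    Pr (\bigcap_(i in [set` J]) Z i @^-1` A i) = \prod_(i in J) Pr (Z i @^-1` A i).

Definition iid (P : probability T R) (I : finType) (Z : I -> {RV Pr >-> T}) : Prop :=
  mutually_independent Z /\
  forall i (A : set T), measurable A -> distribution Pr (Z i) A = P A.

End iid.

(* Main.v *)
(* First-order optimality of each step and strong convexity give, for every
   sample, the regret bound
     sum_m alpha_m <g^m, w^m - w>
       <= psi w - psi w^1 + 1/2 sum_m alpha_m^2 ||g^m||_*^2,
   where the Bregman divergences telescope and the last one absorbs the n-th
   term, so that w^(n+1) is not needed. The subgradient inequality bounds the
   left-hand side below by sum_m alpha_m (l(z_m, w^m) - l(z_m, w)). Since w^m is
   measurable for the sigma-algebra of z_1, ..., z_(m-1), from which z_m and the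
   test pair z_0 are independent, E l(z_m, w^m) = E F(w^m) = E l(z_0, w^m), and
   Jensen's inequality passes to the weighted average. All integrands are kept
   nonnegative by moving l(z_m, w) to the right-hand side, so that Tonelli's
   theorem suffices. The iterates are measurable because the minimiser of
   psi - <theta, .> on W is a Lipschitz function of theta. *)
Require Import Defs.
From HB Require Import structures.
From mathcomp Require Import all_boot all_order all_algebra.
From mathcomp Require Import all_classical all_reals all_analysis.
From mathcomp Require Import measurable_realfun ring lra.

Set Implicit Arguments.
Unset Strict Implicit.
Unset Printing Implicit Defensive.

Import Order.TTheory GRing.Theory Num.Theory.
Import numFieldNormedType.Exports.

Local Open Scope classical_set_scope.
Local Open Scope ring_scope.

(** * Bilinearity and continuity of the inner product *)

Section inner_product.
Context (R : realType) (m n : nat).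
Implicit Types a b u v : 'M[R]_(m, n).

Lemma innerDl a b v : inner (a + b) v = inner a v + inner b v.
Proof.
rewrite /inner -big_split; apply: eq_bigr => i _ /=.
by rewrite -big_split; apply: eq_bigr => j _; rewrite mxE mulrDl.
Qed.

Lemma innerC a b : inner a b = inner b a.
Proof. by apply: eq_bigr => i _; apply: eq_bigr => j _; rewrite mulrC. Qed.

Lemma innerDr a u v : inner a (u + v) = inner a u + inner a v.
Proof. by rewrite !(innerC a) innerDl. Qed.

Lemma innerZl (c : R) a v : inner (c *: a) v = c * inner a v.
Proof.
rewrite /inner mulr_sumr; apply: eq_bigr => i _.
by rewrite mulr_sumr; apply: eq_bigr => j _; rewrite mxE mulrA.
Qed.

Lemma innerZr (c : R) a v : inner a (c *: v) = c * inner a v.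
Proof. by rewrite !(innerC a) innerZl. Qed.

Lemma innerNl a v : inner (- a) v = - inner a v.
Proof. by rewrite -scaleN1r innerZl mulN1r. Qed.

Lemma innerNr a v : inner a (- v) = - inner a v.
Proof. by rewrite !(innerC a) innerNl. Qed.

Lemma innerBl a b v : inner (a - b) v = inner a v - inner b v.
Proof. by rewrite innerDl innerNl. Qed.

Lemma innerBr a u v : inner a (u - v) = inner a u - inner a v.
Proof. by rewrite innerDr innerNr. Qed.

Lemma inner0r a : inner a 0 = 0.
Proof. by rewrite -(scale0r 0) innerZr mul0r. Qed.

Lemma inner_sumr a (I : Type) (r : seq I) (Q : pred I) (v : I -> 'M[R]_(m, n)) :
  inner a (\sum_(i <- r | Q i) v i) = \sum_(i <- r | Q i) inner a (v i).
Proof. exact: (big_morph _ (innerDr a) (inner0r a)). Qed.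

Lemma inner_le_entries a v (b : R) : (forall i j, `|v i j| <= b) ->
  inner a v <= (\sum_i \sum_j `|a i j|) * b.
Proof.
move=> vb; rewrite mulr_suml; apply: ler_sum => i _.
rewrite mulr_suml; apply: ler_sum => j _.
by rewrite (le_trans (ler_norm _))// normrM ler_wpM2l.
Qed.

Lemma continuous_inner v : continuous (fun a : 'M[R]_(m, n) => inner a v).
Proof.
apply: (continuous_big (@add_continuous _)) => i _.
apply: (continuous_big (@add_continuous _)) => j _ a.
apply: (@cvgMr_tmp _ _ _ _ (fun a : 'M[R]_(m, n) => a i j)).
  exact: (nbhs_filter a).
exact: (@coord_continuous R m n i j a).
Qed.

End inner_product.

Lemma lipschitz_continuous (R : realType) (V V' : normedModType R)
    (f : V -> V') (C : R) :
  (forall u v, `|f u - f v| <= C * `|u - v|) -> continuous f.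
Proof.
(* Since [C] may vanish or be negative, the positive constant [|C| + 1] replaces it. *)
move=> fC v; have C1 : 0 < `|C| + 1 by rewrite ltr_wpDl.
apply/pseudometric_normed_Zmodule.cvgrPdist_lt => e e0; near=> u.
rewrite (le_lt_trans (fC _ _))// (@le_lt_trans _ _ ((`|C| + 1) * `|v - u|))//.
  by rewrite ler_wpM2r// (le_trans (ler_norm _))// lerDl.
rewrite mulrC -ltr_pdivlMr//.
near: u; apply: (@pseudometric_normed_Zmodule.cvgr_dist_lt _ _ _ (nbhs v) _ id v) => //.
exact: divr_gt0.
Unshelve. all: by end_near. Qed.

(** * Equivalence of an arbitrary norm with the entrywise maximum norm *)

Section norms.
Context (R : realType).

Lemma is_norm0 (V : lmodType R) (N : V -> R) : is_norm N -> N 0 = 0.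
Proof. by case=> _ _ NZ; rewrite -(scale0r 0) NZ normr0 mul0r. Qed.

Lemma is_normN (V : lmodType R) (N : V -> R) v : is_norm N -> N (- v) = N v.
Proof. by case=> _ _ NZ; rewrite -scaleN1r NZ normrN1 mul1r. Qed.

Lemma is_norm_ge0 (V : lmodType R) (N : V -> R) v : is_norm N -> 0 <= N v.
Proof.
move=> NN; have [_ ND _] := NN.
by have := ND v (- v); rewrite subrr is_norm0// is_normN// -mulr2n pmulrn_lge0.
Qed.

Lemma is_norm_sum (V : lmodType R) (N : V -> R) (I : Type) (r : seq I)
    (v : I -> V) : is_norm N -> N (\sum_(i <- r) v i) <= \sum_(i <- r) N (v i).
Proof.
move=> NN; have [_ ND _] := NN.
elim/big_rec2 : _ => [|i y x _ yx]; first by rewrite is_norm0.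
by rewrite (le_trans (ND _ _))// lerD2l.
Qed.

(** Expanding in the standard basis bounds [N] by a multiple [C] of the maximum norm; the reverse
    triangle inequality turns this into a Lipschitz estimate. *)
Lemma is_norm_rV_continuous p (N : 'rV[R]_p -> R) : is_norm N -> continuous N.
Proof.
move=> NN; have [_ ND NZ] := NN.
pose C := \sum_i N (delta_mx 0 i).
have C0 : 0 <= C by apply: sumr_ge0 => i _; exact: is_norm_ge0.
have NC v : N v <= C * `|v|.
  rewrite [in leLHS](row_sum_delta v) (le_trans (is_norm_sum _ _ NN))//.
  rewrite mulr_suml; apply: ler_sum => i _.
  rewrite NZ mulrC ler_wpM2l ?is_norm_ge0//.
  by rewrite [leRHS]/Num.Def.normr/= mx_normrE; apply: (le_bigmax _ _ (0, i)).
have NL u v : `|N u - N v| <= C * `|u - v|.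
  rewrite ler_norml; apply/andP; split.
    rewrite lerNl opprB lerBlDr (le_trans _ (lerD (NC _) (lexx _)))//.
    by rewrite -opprB is_normN// (le_trans _ (ND _ _))// subrK.
  by rewrite lerBlDr (le_trans _ (lerD (NC _) (lexx _)))// (le_trans _ (ND _ _))// subrK.
exact: (lipschitz_continuous NL).
Qed.

(* The constant is the minimum of [N] on the unit sphere, which is compact. *)
Lemma is_norm_rV_lower_bound p (N : 'rV[R]_p -> R) : is_norm N ->
  exists2 c, 0 < c & forall v, c * `|v| <= N v.
Proof.
move=> NN; have [N0 ND NZ] := NN.
pose S := [set v : 'rV[R]_p | `|v| = 1].
(* If the sphere is empty, zero is the only vector and any positive constant works. *)
have [/eqP S0|/set0P Sn0] := boolP (S == set0).
  exists 1 => // v; have [->|v0] := eqVneq v 0.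
    by rewrite normr0 mulr0 is_norm0.
  suff : S (`|v|^-1 *: v) by rewrite S0.
  by rewrite /S/= normrZ normfV normr_id mulVf// normr_eq0.
have cS : compact S.
  apply: bounded_closed_compact.
    by exists 1; split; [exact: real1|move=> x x1 v /= ->; exact: ltW].
  rewrite (_ : S = (fun v : 'rV[R]_p => `|v|) @^-1` [set 1]) ?predeqE//.
  apply: preimage_closed; last exact: closed_eq.
  by move=> v _; exact: norm_continuous.
have Nc : {within S, continuous N}.
  by apply: continuous_subspaceT; exact: is_norm_rV_continuous.
have [u /[!inE] Su minu] := EVT_min_rV Sn0 cS Nc.
exists (N u) => [|v].
  rewrite lt_neqAle is_norm_ge0// andbT eq_sym; apply/eqP => /N0 u0.
  by move: Su; rewrite /S/= u0 normr0 => /esym/eqP; rewrite oner_eq0.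
have [->|v0] := eqVneq v 0; first by rewrite normr0 mulr0 is_norm0.
have v0' : 0 < `|v| by rewrite normr_gt0.
have : `|v|^-1 *: v \in S.
  by rewrite inE /S/= normrZ normfV normr_id mulVf// gt_eqF.
by move/minu; rewrite NZ ger0_norm ?invr_ge0// ler_pdivlMl// mulrC.
Qed.

(** Flattening by [mxvec] reduces the claim to row vectors, where the compactness argument was
    carried out. *)
Lemma is_norm_lower_bound m n (N : 'M[R]_(m, n) -> R) : is_norm N ->
  exists2 c, 0 < c & forall (v : 'M[R]_(m, n)) i j, `|v i j| <= c * N v.
Proof.
move=> NN; have [N0 ND NZ] := NN.
have [|c c0 cN] := @is_norm_rV_lower_bound _ (N \o vec_mx).
  split=> [v /= /N0 /(congr1 mxvec)|u v|a v]/=.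
  - by rewrite vec_mxK linear0.
  - by rewrite linearD; exact: ND.
  - by rewrite linearZ; exact: NZ.
exists c^-1 => [|v i j]; first by rewrite invr_gt0.
rewrite ler_pdivlMl//; have := cN (mxvec v); rewrite /= mxvecK.
apply: le_trans; rewrite ler_pM2l// -mxvecE [leRHS]/Num.Def.normr/= mx_normrE.
exact: (le_bigmax _ (fun ij : 'I_1 * 'I_(m * n) => `|mxvec v ij.1 ij.2|)
  (0, mxvec_index i j)).
Qed.

End norms.

(** * The dual norm as a finite supremum of linear forms *)

Section dual_norm.
Context (R : realType) (m n : nat) (N : 'M[R]_(m, n) -> R).
Hypothesis NN : is_norm N.

Let B g := [set inner g w | w in [set w | N w <= 1]].

(** On the unit ball of [N] all entries are bounded by one constant, so [dual_norm] is a genuine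
    supremum and not the default value of [sup]. *)
Lemma has_sup_dual_norm g : has_sup (B g).
Proof.
split; first by exists (inner g 0), 0; rewrite //= (is_norm0 NN) ler01.
have [c c0 cN] := is_norm_lower_bound NN.
exists ((\sum_i \sum_j `|g i j|) * c) => _ [w /= w1 <-].
apply: inner_le_entries => i j; rewrite (le_trans (cN _ _ _))//.
by rewrite ler_piMr// ltW.
Qed.

(** Hölder's inequality: for [v] nonzero, [v] divided by [N v] competes in the supremum. *)
Lemma inner_le_dual_norm g v : inner g v <= dual_norm N g * N v.
Proof.
have [_ _ NZ] := NN; have [N0 _ _] := NN.
have [->|v0] := eqVneq v 0; first by rewrite inner0r is_norm0// mulr0.
have Nv : 0 < N v.
  rewrite lt_neqAle is_norm_ge0// andbT eq_sym.
  by apply: contra_neq v0 => /N0.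
rewrite -ler_pdivrMr// mulrC -innerZr.
apply: ub_le_sup; first by have [] := has_sup_dual_norm g.
exists ((N v)^-1 *: v) => //=.
by rewrite NZ ger0_norm ?invr_ge0 ?is_norm_ge0// mulVf// gt_eqF.
Qed.

(** A supremum of continuous functions is lower semicontinuous. This is enough to make the dual norm
    Borel. *)
Lemma open_dual_norm_gt (r : R) : open [set g | r < dual_norm N g].
Proof.
rewrite (_ : mkset _ = \bigcup_(w in [set w | N w <= 1])
    [set g : 'M[R]_(m, n) | r < inner g w]).
  apply: bigcup_open => w _.
  apply: (@open_comp _ _ (fun g => inner g w) [set x | r < x]).
    by move=> g _; exact: continuous_inner.
  exact: open_gt.
apply/seteqP; split=> g /=.
  move=> rg; have [_ [w w1 <-] rw] := sup_gt (proj1 (has_sup_dual_norm g)) rg.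
  by exists w.
move=> [w w1] rw; apply: lt_le_trans rw _.
by apply: ub_le_sup; [have [] := has_sup_dual_norm g|exists w].
Qed.

End dual_norm.

(** * Measurability of matrix-valued maps *)

Section matrix_measurability.
Context (R : realType) (d : measure_display) (S : measurableType d).

Lemma open_measurable_mx m n (A : set 'M[R]_(m, n)) : open A -> measurable A.
Proof. exact: sub_sigma_algebra. Qed.

Lemma closed_measurable_mx m n (A : set 'M[R]_(m, n)) : closed A -> measurable A.
Proof.
by move=> cA; rewrite -(setCK A); apply: measurableC;
  apply: open_measurable_mx; exact: closed_openC.
Qed.

Lemma measurable_fun_mx_open m n (f : S -> 'M[R]_(m, n)) :
  (forall A, open A -> measurable (f @^-1` A)) -> measurable_fun setT f.
Proof.
move=> fA; apply: (measurability (@open 'M[R]_(m, n))) => //.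
by move=> _ [A oA <-]; rewrite setTI; exact: fA.
Qed.

Lemma measurable_entry m n (f : S -> 'M[R]_(m, n)) i j :
  measurable_fun setT f -> measurable_fun setT (fun s => f s i j).
Proof.
move=> mf; apply: (measurability _ (RGenOInfty.measurableE R)) => //.
move=> _ [_ [r ->] <-]; rewrite setTI.
rewrite (_ : _ @^-1` _ = f @^-1` ((fun a : 'M[R]_(m, n) => a i j) @^-1` [set x | r < x])).
  rewrite -[X in measurable X]setTI; apply: mf => //; apply: open_measurable_mx.
  by apply: open_comp (@open_gt _ _) => a _; exact: coord_continuous.
by apply/seteqP; split=> s /=; rewrite in_itv/= andbT.
Qed.

(** Every open set is a union of boxes with rational centres and radii, of which there are countably
    many. This links the Borel sigma-algebra of the topology to the entries. *)
Lemma measurable_mxP m n (f : S -> 'M[R]_(m, n)) :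
  (forall i j, measurable_fun setT (fun s => f s i j)) -> measurable_fun setT f.
Proof.
move=> mf; apply: measurable_fun_mx_open => A oA.
pose box (q : 'M[rat]_(m, n) * rat) :=
  [set a : 'M[R]_(m, n) | forall i j, `|ratr (q.1 i j) - a i j| < ratr q.2].
have -> : f @^-1` A =
    \bigcup_q [set s | box q `<=` A /\ box q (f s)].
  apply/seteqP; split=> [s /= As|s [q _ [qA qs]]]; last exact: qA.
  have /nbhs_ballP[e /= e0 eA] : nbhs (f s) A by exact: open_nbhs_nbhs.
  (* A box of radius [r < e / 2] whose centre has entries within [r] of those of [f s] contains
     [f s] and lies in the ball of radius [e]. *)
  have [r] : exists r, ratr r \in `]0, e / 2[ by apply: rat_in_itvoo; rewrite divr_gt0.
  rewrite in_itv/= => /andP[r0 re].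
  have /choice[q qP] : forall ij : 'I_m * 'I_n,
      exists q, `|ratr q - f s ij.1 ij.2| < ratr r.
    move=> [i j]; have [|q] := @rat_in_itvoo R (f s i j - ratr r) (f s i j + ratr r).
      by rewrite ltrBlDr -addrA ltrDl addr_gt0.
    by rewrite in_itv/= -ltr_distl => qr; exists q.
  exists (\matrix_(i, j) q (i, j), r) => //; split=> [a aq|]/=; last first.
    by move=> i j; rewrite mxE; exact: (qP (i, j)).
  apply: eA; split=> // i j.
  rewrite /ball/= -(subrKA (ratr (q (i, j)))) (le_lt_trans (ler_normD _ _))//.
  rewrite [ltRHS]splitr ltrD//.
    by rewrite distrC (lt_trans (qP (i, j))).
  by have := aq i j; rewrite /= mxE => /lt_trans; exact.
apply: countable_bigcupT_measurable => [|q]; first exact: countableP.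
have [qA|qA] := pselect (box q `<=` A); last first.
  by rewrite [X in measurable X](_ : _ = set0)//; apply/seteqP; split=> s // -[].
rewrite [X in measurable X](_ : _ =
    \bigcap_(ij in [set: 'I_m * 'I_n])
      [set s | `|ratr (q.1 ij.1 ij.2) - f s ij.1 ij.2| < ratr q.2]); last first.
  apply/seteqP; split=> s /= => [[_ qs] ij _|qs]; first exact: qs.
  by split=> // i j; exact: (qs (i, j)).
apply: fin_bigcap_measurable => // -[i j] _ /=.
have := @measurable_fun_ltr _ _ _ setT (fun s => `|ratr (q.1 i j) - f s i j|) (cst (ratr q.2)).
move=> /(_ _ _ measurableT [set true]); rewrite setTI; apply => //.
by apply: measurableT_comp => //; apply: measurable_funB => //; exact: mf.
Qed.

(** On [D], the preimage of an open set under [h] agrees with some open set [V], and [f] only takes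
    values in [D]. It serves for the gradient of [psi], which is continuous on [W] only. *)
Lemma measurable_within_continuous m n m' n' (D : set 'M[R]_(m, n))
    (h : 'M[R]_(m, n) -> 'M[R]_(m', n')) (f : S -> 'M[R]_(m, n)) :
  {within D, continuous h} -> measurable_fun setT f -> (forall s, D (f s)) ->
  measurable_fun setT (h \o f).
Proof.
move=> ch mf fD; apply: measurable_fun_mx_open => A oA.
have /continuousP/(_ _ oA)/open_subspaceP[V oV VD] := ch.
rewrite (_ : _ @^-1` A = f @^-1` V).
  by rewrite -[X in measurable X]setTI; apply: mf => //; exact: open_measurable_mx.
apply/seteqP; split=> s /= As.
  have : ((h @^-1` A) `&` D) (f s) by [].
  by rewrite -VD => -[].
have : (V `&` D) (f s) by [].
by rewrite VD => -[].
Qed.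

Lemma measurable_dual_norm m n (N : 'M[R]_(m, n) -> R) (f : S -> 'M[R]_(m, n)) :
  is_norm N -> measurable_fun setT f ->
  measurable_fun setT (fun s => dual_norm N (f s)).
Proof.
move=> NN mf; apply: (measurability _ (RGenOInfty.measurableE R)) => //.
move=> _ [_ [r ->] <-].
rewrite setTI (_ : _ @^-1` _ = f @^-1` [set g | r < dual_norm N g]).
  rewrite -[X in measurable X]setTI; apply: mf => //.
  by apply: open_measurable_mx; exact: open_dual_norm_gt.
by apply/seteqP; split=> s /=; rewrite in_itv/= andbT.
Qed.

Lemma measurable_inner m n (f g : S -> 'M[R]_(m, n)) :
  measurable_fun setT f -> measurable_fun setT g ->
  measurable_fun setT (fun s => inner (f s) (g s)).
Proof.
move=> mf mg; apply: measurable_sum => i; apply: measurable_sum => j.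
by apply: measurable_funM; exact: measurable_entry.
Qed.

End matrix_measurability.

(** * Joint measurability of the loss in the data and the parameter *)

Section loss_measurability.
Context (R : realType) (dim k : nat) (k1 : (1 < k)%N).
Context (X : set 'cV[R]_dim) (X0 : X !=set0).
Context (d : measure_display) (S : measurableType d).

Lemma measurable_vec : measurable_fun setT (@vec R dim X X0).
Proof.
move=> _ A mA; rewrite setTI; exists A => //; exact: setTI.
Qed.

Lemma measurable_score (x : S -> instance X0) (w : S -> 'M[R]_(dim, k)) y :
  measurable_fun setT x -> measurable_fun setT w ->
  measurable_fun setT (fun s => score (vec (x s)) y (w s)).
Proof.
move=> mx mw; apply: measurable_inner.
  exact: measurableT_comp measurable_vec mx.
apply: measurable_mxP => i j.
under eq_fun do rewrite mxE.
exact: measurable_entry.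
Qed.

(** The space is cut into the finitely many measurable pieces on which [y] is constant. *)
Lemma measurable_class_fun (dT : measure_display) (T : measurableType dT)
    (y : S -> class k1) (f : 'I_k -> S -> T) :
  measurable_fun setT y -> (forall i, measurable_fun setT (f i)) ->
  measurable_fun setT (fun s => f (y s) s).
Proof.
move=> my mf _ A mA; rewrite setTI.
have -> : (fun s => f (y s) s) @^-1` A =
    \bigcup_(i in [set: 'I_k]) ((y @^-1` [set i]) `&` (f i @^-1` A)).
  by apply/seteqP; split=> [s As|s [i _ [<-]]//]; exists (y s).
apply: fin_bigcup_measurable => // i _; apply: measurableI.
  by rewrite -[X in measurable X]setTI; exact: my.
by rewrite -[X in measurable X]setTI; exact: mf.
Qed.

(** A finite maximum exceeds [r] exactly when one of the scores does, so superlevel sets are finite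
    unions. *)
Lemma measurable_sup_scores (x : S -> instance X0) (w : S -> 'M[R]_(dim, k)) (i : 'I_k) :
  measurable_fun setT x -> measurable_fun setT w ->
  measurable_fun setT
    (fun s => sup [set score (vec (x s)) y' (w s) | y' in [set y' | y' != i]]).
Proof.
move=> mx mw; apply: (measurability _ (RGenOInfty.measurableE R)) => //.
move=> _ [_ [r ->] <-]; rewrite setTI.
rewrite [X in measurable X](_ : _ = \bigcup_(y' in [set y' | y' != i])
    ((fun s => score (vec (x s)) y' (w s)) @^-1` `]r, +oo[)).
  apply: fin_bigcup_measurable => [|y' _]; first exact: finite_finset.
  by rewrite -[X in measurable X]setTI; exact: measurable_score.
apply/seteqP; split=> s /=; rewrite in_itv/= andbT.
  move/(@sup_gt R) => [|_ [y' y'i <-] rs]; last by exists y' => //=; rewrite in_itv/= rs.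
  (* Since [k >= 2], class 0 or class 1 differs from [i], so the set of competing scores is
     nonempty. *)
  pose j : 'I_k := if i == Ordinal (ltnW k1) then Ordinal k1 else Ordinal (ltnW k1).
  exists (score (vec (x s)) j (w s)), j => //=; rewrite /j.
  by case: (eqVneq i (Ordinal (ltnW k1))) => [->|]; last by rewrite eq_sym.
move=> [y' y'i] /=; rewrite in_itv/= andbT => rs; apply: lt_le_trans rs _.
apply: ub_le_sup; last by exists y'.
exists (\sum_j `|score (vec (x s)) j (w s)|) => _ [j _ <-].
rewrite (bigD1 j)//= (le_trans (ler_norm _))// lerDl.
exact: sumr_ge0.
Qed.

Lemma measurable_loss rho (x : S -> instance X0) (y : S -> class k1)
    (w : S -> 'M[R]_(dim, k)) :
  measurable_fun setT x -> measurable_fun setT y -> measurable_fun setT w ->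
  measurable_fun setT (fun s => loss rho (vec (x s)) (y s) (w s)).
Proof.
move=> mx my mw.
apply: (measurable_class_fun (f := fun i s => loss rho (vec (x s)) i (w s))) => // i.
apply: measurable_maxr => //; apply: measurable_funB => //.
apply: measurable_funM => //; apply: measurable_funB; first exact: measurable_score.
exact: measurable_sup_scores.
Qed.

End loss_measurability.

(** * Positive weights and convex averages *)

Lemma sum_weights_gt0 (R : numDomainType) (alpha : nat -> R) p :
  (forall i, (1 <= i <= p.+1)%N -> 0 < alpha i) ->
  0 < \sum_(1 <= i < p.+2) alpha i.
Proof.
move=> a0; rewrite big_nat_recr//=; apply: ltr_wpDl; last by apply: a0; rewrite /= leqnn.
rewrite big_nat; apply: sumr_ge0 => i /andP[i1 ip].
by rewrite ltW// a0// i1/= ltnW.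
Qed.

Section convexity.
Context (R : realType) (m n : nat) (W : set 'M[R]_(m, n)).
Hypothesis W_convex : convex_set (W : set (convex_lmodType 'M[R]_(m, n))).

Lemma convex_set_conv u v (t : R) : W u -> W v -> 0 <= t -> t <= 1 ->
  W (t *: u + (1 - t) *: v).
Proof.
move=> Wu Wv t0 t1.
by have := W_convex (Itv01 t0 t1) (mem_set Wu) (mem_set Wv); rewrite inE.
Qed.

(** By induction: the average of [p.+2] points is a convex combination of the average of the first
    [p.+1] and the last point. *)
Lemma convex_set_weighted_average (alpha : nat -> R) p (w : nat -> 'M[R]_(m, n)) :
  (forall i, (1 <= i <= p.+1)%N -> 0 < alpha i) ->
  (forall i, (1 <= i <= p.+1)%N -> W (w i)) ->
  W (weighted_average alpha p.+1 w).
Proof.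
rewrite /weighted_average; elim: p => [|p IH] a0 Ww.
  rewrite !big_nat1 scalerA mulVf; first by rewrite scale1r; exact: Ww.
  by rewrite gt_eqF// a0.
have {}IH : W ((\sum_(1 <= i < p.+2) alpha i)^-1 *: \sum_(1 <= i < p.+2) alpha i *: w i).
  by apply: IH => i /andP[i1 ip]; [apply: a0|apply: Ww]; rewrite i1 (leq_trans ip).
rewrite !(big_nat_recr p.+2)//=.
set A := \sum_(1 <= i < p.+2) alpha i in IH *; set a := alpha p.+2.
set s := \sum_(1 <= i < p.+2) alpha i *: w i in IH *.
have A0 : 0 < A.
  by apply: sum_weights_gt0 => i /andP[i1 ip]; apply: a0; rewrite i1 (leq_trans ip).
have a'0 : 0 < a by apply: a0; rewrite leqnn.
have Aa : 0 < A + a by rewrite addr_gt0.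
have -> : (A + a)^-1 *: (s + a *: w p.+2) =
    (A / (A + a)) *: (A^-1 *: s) + (1 - A / (A + a)) *: w p.+2.
  rewrite scalerDr !scalerA; congr (_ *: _ + _ *: _).
    by field; rewrite !gt_eqF.
  by field; rewrite gt_eqF.
apply: convex_set_conv => //; first by apply: Ww; rewrite leqnn.
  by rewrite divr_ge0// ltW.
by rewrite ler_pdivrMr// mul1r lerDl ltW.
Qed.

End convexity.

(** * Deterministic analysis of mirror descent *)

Section mirror_step.
Context (R : realType) (m n : nat) (N : 'M[R]_(m, n) -> R) (NN : is_norm N).
Context (W : set 'M[R]_(m, n)) (psi : 'M[R]_(m, n) -> R).
Hypothesis W_convex : convex_set (W : set (convex_lmodType 'M[R]_(m, n))).
Hypothesis psi_diff : forall w, W w -> differentiable psi w.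
Hypothesis psi_sc : forall u w, W u -> W w ->
  2^-1 * N (u - w) ^+ 2 <= bregman psi u w.

(** Differentiability makes the directional derivative linear in [v], so the matrix of partial
    derivatives represents it. *)
Lemma derive_gradient w v : differentiable psi w ->
  'D_v psi w = inner (gradient psi w) v.
Proof.
move=> dw; rewrite deriveE// {1}(matrix_sum_delta v) linear_sum.
apply: eq_bigr => i _; rewrite linear_sum; apply: eq_bigr => j _.
by rewrite linearZ/= mxE deriveE// mulrC.
Qed.

(* First-order optimality: on the segment from [w] to [u], contained in [W], the
   difference quotients of [psi] at [w] are at least [inner theta (u - w)]. *)
Lemma argmin_variational theta w u :
  is_argmin W (fun v => psi v - inner theta v) w -> W u ->
  inner theta (u - w) <= inner (gradient psi w) (u - w).
Proof.
move=> [Ww minw] Wu; have dw := psi_diff Ww.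
rewrite -derive_gradient//.
have /cvg_dnbhs_at_right/cvgr_to_ge : derivable psi w (u - w) by exact: diff_derivable.
apply.
near=> h.
have h0 : 0 < h by [].
have h1 : h <= 1 by near: h; exact: nbhs_right_le.
rewrite /= -[_ *: _]/(_ * _) ler_pdivlMl//.
have : W (h *: (u - w) + w).
  have := convex_set_conv W_convex Wu Ww (ltW h0) h1.
  by rewrite scalerBr scalerBl scale1r addrA addrAC.
move=> /minw; rewrite [inner theta (_ *: _ + _)]innerDr innerZr; lra.
Unshelve. all: by end_near. Qed.

(** The two objectives differ by a term constant in [u]. Each step thus becomes a linear
    perturbation of [psi], the form in which optimality and stability are stated. *)
Lemma mirror_argmin g w w' (a : R) :
  is_argmin W (fun u => bregman psi u w + a * inner g (u - w)) w' ->
  is_argmin W (fun u => psi u - inner (gradient psi w - a *: g) u) w'.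
Proof.
move=> [Ww' minw']; split=> // u /minw'.
rewrite /bregman innerBl innerZl !innerBr innerBl innerZl; lra.
Qed.

(** The two variational inequalities, each tested at the other minimiser, are added to the two
    strong convexity inequalities; all values of [psi] cancel. *)
Lemma argmin_lipschitz t1 t2 w1 w2 :
  is_argmin W (fun u => psi u - inner t1 u) w1 ->
  is_argmin W (fun u => psi u - inner t2 u) w2 ->
  N (w1 - w2) ^+ 2 <= inner (t1 - t2) (w1 - w2).
Proof.
move=> m1 m2; have [W1 _] := m1; have [W2 _] := m2.
have := argmin_variational m1 W2; have := argmin_variational m2 W1.
have := psi_sc W1 W2; have := psi_sc W2 W1.
rewrite -[w2 - w1]opprB is_normN// /bregman -[w2 - w1]opprB !innerNr innerBl.
lra.
Qed.

(** Hölder's inequality, then expansion of the nonnegative square of [N v - a * dual_norm N g]. *)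
Lemma fenchel_young g v (a : R) : 0 <= a ->
  a * inner g v <= 2^-1 * N v ^+ 2 + 2^-1 * (a ^+ 2 * dual_norm N g ^+ 2).
Proof.
move=> a0; have := ler_wpM2l a0 (inner_le_dual_norm NN g v).
have := sqr_ge0 (N v - a * dual_norm N g).
nra.
Qed.

(** Optimality of [w'] tested at [u] leaves the error [a * inner g (w - w') - bregman psi w' w].
    Fenchel-Young produces half of [N (w - w')] squared, which strong convexity absorbs. *)
Lemma mirror_step g w w' u (a : R) : 0 <= a -> W w -> W u ->
  is_argmin W (fun u => bregman psi u w + a * inner g (u - w)) w' ->
  bregman psi u w' + a * inner g (w - u) <=
  bregman psi u w + 2^-1 * (a ^+ 2 * dual_norm N g ^+ 2).
Proof.
move=> a0 Ww Wu mw'; have [Ww' _] := mw'.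
have := argmin_variational (mirror_argmin mw') Wu.
have := fenchel_young g (w - w') a0; have := psi_sc Ww' Ww.
rewrite -[w' - w]opprB is_normN// /bregman.
rewrite !innerBl !innerZl !innerBr; lra.
Qed.

Lemma mirror_descent_regret p (alpha : nat -> R) (g w : nat -> 'M[R]_(m, n)) u :
  (forall i, (1 <= i <= p.+1)%N -> 0 < alpha i) -> is_argmin W psi (w 1%N) ->
  (forall i, (1 <= i < p.+1)%N -> is_argmin W
     (fun v => bregman psi v (w i) + alpha i * inner (g i) (v - w i)) (w i.+1)) ->
  W u ->
  \sum_(1 <= i < p.+2) alpha i * inner (g i) (w i - u) <=
  psi u - psi (w 1%N) +
  2^-1 * \sum_(1 <= i < p.+2) alpha i ^+ 2 * dual_norm N (g i) ^+ 2.
Proof.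
move=> a0 m1 ms Wu.
have Ww i : (1 <= i <= p.+1)%N -> W (w i).
  case: i => [//|[_|i]]; first by have [] := m1.
  by move=> ip; have [] := ms i.+1 ip.
have step j : (j <= p)%N ->
    \sum_(1 <= i < j.+1) alpha i * inner (g i) (w i - u) + bregman psi u (w j.+1) <=
    psi u - psi (w 1%N) +
    2^-1 * \sum_(1 <= i < j.+1) alpha i ^+ 2 * dual_norm N (g i) ^+ 2.
  elim: j => [_|j IH jp].
    (* For empty sums the claim is that [inner (gradient psi (w 1)) (u - w 1)] is nonnegative:
       first-order optimality with [theta = 0]. *)
    rewrite !big_geq// add0r mulr0 addr0 /bregman gerBl.
    rewrite -(_ : inner 0 (u - w 1%N) = 0); last by rewrite innerC inner0r.
    apply: argmin_variational => //; case: m1 => W1 m1; split=> // v /m1.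
    by rewrite !(innerC 0) !inner0r !subr0.
  have {}IH := IH (ltnW jp); rewrite !(big_nat_recr j.+1)//= mulrDr.
  have aj : 0 <= alpha j.+1 by rewrite ltW// a0//= ltnW.
  have := mirror_step aj (Ww j.+1 (ltnW jp)) Wu (ms j.+1 jp).
  lra.
(* For the last term, strong convexity bounds the remaining [bregman psi u (w p.+1)] below by
   exactly the square that Fenchel-Young creates. *)
have {}step := step p (leqnn p); rewrite !(big_nat_recr p.+1)//= mulrDr.
have ap : 0 <= alpha p.+1 by rewrite ltW// a0//=.
have := fenchel_young (g p.+1) (w p.+1 - u) ap.
have := psi_sc Wu (Ww p.+1 (leqnn _)); rewrite -[u - _]opprB is_normN//.
lra.
Qed.

End mirror_step.

(** * Measurability of the iterates through stability of minimisers *)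

Section mirror_measurability.
Context (R : realType) (m n : nat) (N : 'M[R]_(m, n) -> R) (NN : is_norm N).
Context (W : set 'M[R]_(m, n)) (psi : 'M[R]_(m, n) -> R).
Hypothesis W_convex : convex_set (W : set (convex_lmodType 'M[R]_(m, n))).
Hypothesis psi_diff : forall w, W w -> differentiable psi w.
Hypothesis psi_sc : forall u w, W u -> W w ->
  2^-1 * N (u - w) ^+ 2 <= bregman psi u w.
Hypothesis grad_cont : {within W, continuous (gradient psi)}.
Context (d : measure_display) (S : measurableType d).

Let argmin theta := is_argmin W (fun u => psi u - inner theta u).

(* Stability of the minimiser under perturbation of [theta], stated for all
   minimisers at once so that their existence is not needed. *)
Lemma argmin_stable theta w (A : set 'M[R]_(m, n)) :
  argmin theta w -> nbhs w A ->
  \forall t \near theta, forall w', argmin t w' -> A w'.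
Proof.
move=> mw /nbhs_ballP[e /= e0 eA].
have [c c0 cN] := is_norm_lower_bound NN.
(* The absolute entries of [v] sum to at most [K * N v]. The radius [e / (c * K + 1)] is chosen so
   that its product with [c * K] stays below [e]. *)
pose K := \sum_(i < m) \sum_(j < n) c.
have K0 : 0 <= K by apply: sumr_ge0 => i _; apply: sumr_ge0 => j _; exact: ltW.
have cK : 0 < c * K + 1 by rewrite ltr_wpDl// mulr_ge0// ltW.
apply/nbhs_ballP; exists (e / (c * K + 1)); first by rewrite /= divr_gt0.
move=> t [d0 tt] w' mw'; apply: eA.
have N0 : 0 <= N (w - w') := is_norm_ge0 _ NN.
have le1 : N (w - w') ^+ 2 <= K * N (w - w') * (e / (c * K + 1)).
  apply: le_trans (argmin_lipschitz NN W_convex psi_diff psi_sc mw mw') _.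
  have tt' i j : `|(theta - t) i j| <= e / (c * K + 1).
    by rewrite !mxE ltW//; exact: tt.
  rewrite innerC (le_trans (inner_le_entries _ tt'))// ler_wpM2r// ?(ltW d0)//.
  rewrite mulr_suml; apply: ler_sum => i _; rewrite mulr_suml; apply: ler_sum => j _.
  exact: cN.
have le2 : N (w - w') <= K * (e / (c * K + 1)).
  move: N0; rewrite le_eqVlt => /predU1P[<-|Npos].
    by rewrite mulr_ge0// ltW.
  by rewrite -(ler_pM2r Npos) -expr2 mulrAC.
split=> // i j; have := cN (w - w') i j; rewrite !mxE => /le_lt_trans; apply.
rewrite (le_lt_trans (ler_wpM2l (ltW c0) le2))// !mulrA.
by rewrite ltr_pdivrMr// mulrC ltr_pM2l// ltrDl.
Qed.

(** The preimage of an open [A] under [w] is the preimage under [theta] of an open set of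
    parameters: taking the interior ensures openness, and stability ensures that no [theta s] with
    [w s] in [A] is lost. *)
Lemma measurable_argmin (theta w : S -> 'M[R]_(m, n)) :
  measurable_fun setT theta -> (forall s, argmin (theta s) (w s)) ->
  measurable_fun setT w.
Proof.
move=> mt mw; apply: measurable_fun_mx_open => A oA.
rewrite (_ : w @^-1` A = theta @^-1` (interior [set t | forall w', argmin t w' -> A w'])).
  rewrite -[X in measurable X]setTI; apply: mt => //.
  by apply: open_measurable_mx; exact: open_interior.
apply/seteqP; split=> s /= ws.
  by apply: (argmin_stable (mw s)); exact: open_nbhs_nbhs.
by move/nbhs_singleton: ws; apply; exact: mw.
Qed.

Lemma measurable_mirror_step (g w w' : S -> 'M[R]_(m, n)) (a : R) :
  measurable_fun setT g -> measurable_fun setT w -> (forall s, W (w s)) ->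
  (forall s, is_argmin W
     (fun u => bregman psi u (w s) + a * inner (g s) (u - w s)) (w' s)) ->
  measurable_fun setT w'.
Proof.
move=> mg mw Ww mw'.
apply: (@measurable_argmin (fun s => gradient psi (w s) - a *: g s)) => [|s].
  have mgrad := measurable_within_continuous grad_cont mw Ww.
  apply: measurable_mxP => i j; under eq_fun do rewrite !mxE.
  apply: measurable_funB; last by apply: measurable_funM => //; exact: measurable_entry.
  have := measurable_entry i j mgrad.
  by under eq_fun do rewrite /= mxE.
exact: mirror_argmin.
Qed.

End mirror_measurability.

(** * Independence from the past and integration of a fresh observation *)

Section independence.
Local Open Scope ereal_scope.
Context (R : realType) (dO dT : measure_display).
Context (Omega : measurableType dO) (T : measurableType dT) (Pr : probability Omega R).
Context (P : probability T R).

Section freezing.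
Context (G : set (set Omega)) (Y : {RV Pr >-> T}).
Hypothesis Gm : G `<=` measurable.
Hypothesis GT : G setT.
Hypothesis GI : setI_closed G.
Hypothesis Y_ind : forall B A, G B -> measurable A ->
  Pr (B `&` Y @^-1` A) = Pr B * P A.

(** As functions of [B], both sides are finite measures agreeing on the pi-system [G], hence on the
    sigma-algebra it generates. *)
Lemma independent_sigma_algebra B A : <<s G >> B -> measurable A ->
  Pr (B `&` Y @^-1` A) = Pr B * P A.
Proof.
move=> GB mA.
have mYA : measurable (Y @^-1` A) by rewrite -[X in measurable X]setTI; exact: measurable_funPT.
have PA : P A \is a fin_num by exact: fin_num_measure.
have PA0 : (0 <= fine (P A))%R by exact: fine_ge0.
rewrite muleC -(fineK PA).
apply: (@g_sigma_algebra_measure_unique _ R Omega G Gm (fun=> setT) _ _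
  (mrestr Pr mYA) (mscale (NngNum PA0) Pr)) => //.
- by rewrite bigcup_const.
- by move=> C GC; rewrite [LHS]Y_ind//= /mscale/= fineK// muleC.
- by move=> _; rewrite /= /mrestr setTI (le_lt_trans (probability_le1 _ _))// ltry.
Qed.

Lemma measurable_sub_sigma_algebra (dS : measure_display) (S : measurableType dS)
    (f : Omega -> S) :
  measurable_fun setT (f : g_sigma_algebraType G -> S) -> measurable_fun setT f.
Proof.
move=> mf _ A mA; have := mf measurableT A mA.
by apply: smallest_sub => //; exact: sigma_algebra_measurable.
Qed.

(* The freezing lemma: a variable independent of a sigma-algebra is integrated
   out as if the arguments measurable for that sigma-algebra were constants. *)
Lemma ge0_integral_freezing (f : g_sigma_algebraType G * T -> \bar R) :
  measurable_fun setT f -> (forall p, 0 <= f p) ->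
  measurable_fun setT (fun omega : Omega => \int[P]_t f (omega, t)) /\
  \int[Pr]_omega f (omega, Y omega) = \int[Pr]_omega \int[P]_t f (omega, t).
Proof.
move=> mf f0.
split; first by apply: measurable_sub_sigma_algebra; exact: measurable_fun_fubini_tonelli_F.
have mid : measurable_fun setT (idfun : Omega -> g_sigma_algebraType G).
  by apply: measurable_sub_sigma_algebra; exact: measurable_id.
(* By independence, the joint law of [Y] and the identity into the coarser space is a product
   measure, to which Tonelli's theorem applies. *)
pose h := (fun omega => (idfun omega, Y omega)) : Omega -> g_sigma_algebraType G * T.
have mh : measurable_fun setT h by exact: measurable_fun_pair.
pose id' : {mfun Omega >-> g_sigma_algebraType G} :=
  HB.pack (idfun : Omega -> g_sigma_algebraType G) (isMeasurableFun.Build _ _ _ _ _ mid).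
pose h' : {mfun Omega >-> (g_sigma_algebraType G * T)%type} :=
  HB.pack h (isMeasurableFun.Build _ _ _ _ _ mh).
have prodE (A : set (g_sigma_algebraType G * T)) : measurable A ->
    (distribution Pr id' \x P) A = distribution Pr h' A.
  apply: product_measure_unique => B A' mB mA'.
  rewrite /distribution /pushforward/= -independent_sigma_algebra//.
transitivity (\int[distribution Pr h']_p f p).
  by rewrite ge0_integral_pushforward.
transitivity (\int[distribution Pr id' \x P]_p f p).
  by apply: eq_measure_integral => A mA _; exact/esym/prodE.
rewrite fubini_tonelli1// ge0_integral_pushforward//.
- exact: measurable_fun_fubini_tonelli_F.
- by move=> x _; apply: integral_ge0.
Qed.

End freezing.

Context (I : finType) (Z : I -> {RV Pr >-> T}).

(* The pi-system of cylinders generating the sigma-algebra of the [Z i], [i \in J]. *)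
Definition past (J : {set I}) : set (set Omega) :=
  [set B | exists2 A : I -> set T, (forall i, measurable (A i)) &
     B = \bigcap_(i in [set` J]) Z i @^-1` A i].

Lemma past_measurable J : past J `<=` measurable.
Proof.
move=> _ [A mA ->]; apply: fin_bigcap_measurable; first exact: finite_finset.
by move=> i _; rewrite -[X in measurable X]setTI; exact: measurable_funPT.
Qed.

Lemma pastT J : past J setT.
Proof.
by exists (fun=> setT) => //; apply/esym/seteqP; split.
Qed.

Lemma pastI J : setI_closed (past J).
Proof.
move=> _ _ [A mA ->] [B mB ->]; exists (fun i => A i `&` B i).
  by move=> i; exact: measurableI.
by rewrite -bigcapI.
Qed.

(** Coordinates outside [J] receive the trivial condition [setT]. *)
Lemma sub_past (J J' : {set I}) : J \subset J' -> past J `<=` past J'.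
Proof.
move=> JJ' _ [A mA ->]; exists (fun i => if i \in J then A i else setT).
  by move=> i; case: ifP.
apply/seteqP; split=> omega AZ i iJ /=.
  by case: ifPn => // iJ0; exact: AZ.
by have := AZ i (fintype.subsetP JJ' _ iJ); rewrite iJ.
Qed.

Lemma measurable_past (J : {set I}) i : i \in J ->
  measurable_fun setT (Z i : g_sigma_algebraType (past J) -> T).
Proof.
move=> iJ _ A mA; rewrite setTI; apply: sub_sigma_algebra.
exists (fun j => if j == i then A else setT) => [j|]; first by case: ifP.
apply/seteqP; split=> omega /=.
  by move=> ZA j _ /=; case: eqP => // ->.
by move=> /(_ i iJ); rewrite /= eqxx.
Qed.

Lemma measurable_sub_past (J J' : {set I}) (dS : measure_display)
    (S : measurableType dS) (f : Omega -> S) : J \subset J' ->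
  measurable_fun setT (f : g_sigma_algebraType (past J) -> S) ->
  measurable_fun setT (f : g_sigma_algebraType (past J') -> S).
Proof.
move=> JJ' mf _ A mA; have := mf measurableT A mA.
by apply: sub_smallest2r; [exact: smallest_sigma_algebra|exact: sub_past].
Qed.

(** Adding the condition on [Z i] to a cylinder over [J] gives a cylinder over [i |: J], to which
    mutual independence applies. *)
Lemma past_independent (J : {set I}) i B A : iid P Z -> i \notin J ->
  past J B -> measurable A -> Pr (B `&` Z i @^-1` A) = Pr B * P A.
Proof.
move=> [ind law] iJ [C mC ->] mA.
pose C' j := if j == i then A else C j.
have mC' j : measurable (C' j) by rewrite /C'; case: ifP.
have CE : \bigcap_(j in [set` J]) Z j @^-1` C j = \bigcap_(j in [set` J]) Z j @^-1` C' j.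
  apply: eq_bigcapr => j /= jJ; rewrite /C'.
  by case: eqP => // ji; rewrite ji (negbTE iJ) in jJ.
have -> : (\bigcap_(j in [set` J]) Z j @^-1` C j) `&` Z i @^-1` A =
    \bigcap_(j in [set` i |: J]) Z j @^-1` C' j.
  rewrite CE; apply/seteqP; split=> omega.
    by move=> [CJ ZA] j /=; rewrite !inE => /predU1P[->|]; rewrite ?/C' ?eqxx//; exact: CJ.
  move=> CJ; split=> [j jJ|]; first by apply: CJ => /=; rewrite !inE jJ orbT.
  by have := CJ i; rewrite /= /C' eqxx !inE eqxx; exact.
rewrite CE !ind// big_setU1//= muleC; congr (_ * _).
by rewrite /C' eqxx; exact: law.
Qed.

End independence.

(** * Weighted sums: integration and Jensen's inequality *)

Lemma ge0_integral_weighted_sum (R : realType) (d : measure_display)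
    (S : measurableType d) (mu : {measure set S -> \bar R}) p (c : 'I_p -> R)
    (f : 'I_p -> S -> R) :
  (forall i, 0 <= c i) -> (forall i, measurable_fun setT (f i)) ->
  (forall i s, 0 <= f i s) ->
  (\int[mu]_s (\sum_i c i * f i s)%:E = \sum_i (c i)%:E * \int[mu]_s (f i s)%:E)%E.
Proof.
move=> c0 mf f0.
under eq_integral do rewrite -sumEFin.
rewrite ge0_integral_sum//; last 2 first.
- by move=> i; apply/measurable_EFinP; exact: measurable_funM.
- by move=> i s _; rewrite lee_fin mulr_ge0.
apply: eq_bigr => i _; under eq_integral do rewrite EFinM.
rewrite ge0_integralZl//; first exact/measurable_EFinP.
  by move=> s _; rewrite lee_fin.
by rewrite lee_fin.
Qed.

Lemma loss_ge0 (R : realType) (d k : nat) rho (x : 'cV[R]_d) (y : 'I_k) w :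
  0 <= loss rho x y w.
Proof. by rewrite /loss le_max lexx. Qed.

(* Jensen's inequality, from the subgradient inequality at the average. *)
Lemma subgradient_weighted_average (R : realType) (d k : nat)
    (h : 'M[R]_(d, k) -> R) (alpha : nat -> R) p (w : nat -> 'M[R]_(d, k)) g :
  (forall i, (1 <= i <= p.+1)%N -> 0 < alpha i) ->
  subdifferential h (weighted_average alpha p.+1 w) g ->
  (\sum_(1 <= i < p.+2) alpha i) * h (weighted_average alpha p.+1 w) <=
  \sum_(1 <= i < p.+2) alpha i * h (w i).
Proof.
move=> a0 gh; set v := weighted_average _ _ _ in gh *.
have A0 := sum_weights_gt0 a0.
have vE : (\sum_(1 <= i < p.+2) alpha i) *: v = \sum_(1 <= i < p.+2) alpha i *: w i.
  by rewrite /v /weighted_average scalerA mulfV ?gt_eqF// scale1r.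
have : \sum_(1 <= i < p.+2) alpha i * (h v + inner g (w i - v)) <=
    \sum_(1 <= i < p.+2) alpha i * h (w i).
  rewrite [leLHS]big_nat [leRHS]big_nat; apply: ler_sum => i /andP[i1 ip].
  by apply: ler_wpM2l; [rewrite ltW// a0// i1|exact: gh].
apply: le_trans; under [leRHS]eq_bigr do rewrite mulrDr -innerZr.
(* The linear terms cancel, because the weighted deviations from the average sum to zero. *)
rewrite big_split/= -mulr_suml -inner_sumr.
under [X in inner _ X]eq_bigr do rewrite scalerBr.
by rewrite sumrB -scaler_suml vE subrr inner0r addr0.
Qed.

(* Z 1, ..., Z n is the sample and Z 0 the independent test pair (x, y). *)
Theorem corollary1 (R : realType) (d k : nat) (d_gt0 : (0 < d)%N) (k_gt1 : (1 < k)%N)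
  (X : set 'cV[R]_d) (X0 : X !=set0)
  (P : probability (instance X0 * class k_gt1)%type R)
  (N : 'M[R]_(d, k) -> R) (N_norm : is_norm N)
  (W : set 'M[R]_(d, k)) (W_nonempty : W !=set0) (W_closed : closed W)
  (W_convex : convex_set (W : set (convex_lmodType 'M[R]_(d, k))))
  (rho : R) (rho_gt0 : 0 < rho)
  (risk_finite : forall w, W w -> risk P rho w \is a fin_num)
  (g : instance X0 * class k_gt1 -> 'M[R]_(d, k) -> 'M[R]_(d, k))
  (g_measurable : measurable_fun
     [set p : (instance X0 * class k_gt1) * 'M[R]_(d, k) | W p.2]
     (fun p => g p.1 p.2))
  (g_subgradient : forall (z : instance X0 * class k_gt1) w, W w ->
     subdifferential (loss rho (vec z.1) z.2) w (g z w))
  (psi : 'M[R]_(d, k) -> R)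
  (psi_differentiable : forall w, W w -> differentiable psi w)
  (grad_psi_continuous : {within W, continuous (gradient psi)})
  (psi_strongly_convex : forall u w, W u -> W w ->
     2^-1 * N (u - w) ^+ 2 <= bregman psi u w)
  (U : R) (U_def : (U ^+ 2)%:E = ereal_sup [set (psi u - psi w)%:E | u in W & w in W])
  (G : R) (G_def : (G ^+ 2)%:E =
     ereal_sup [set (\int[P]_z ((dual_norm N (g z w)) ^+ 2)%:E)%E | w in W])
  (n : nat) (n_gt0 : (0 < n)%N)
  (alpha : nat -> R) (alpha_gt0 : forall m, (1 <= m <= n)%N -> 0 < alpha m)
  (dO : measure_display) (Omega : measurableType dO) (Pr : probability Omega R)
  (Z : nat -> {RV Pr >-> (instance X0 * class k_gt1)%type})
  (Z_iid : iid P (fun i : 'I_n.+1 => Z i))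
  (it : nat -> Omega -> 'M[R]_(d, k))
  (it_run : forall omega : Omega, mirror_descent W psi g alpha n
     (fun m => Z m omega) (fun m => it m omega))
  (w : 'M[R]_(d, k)) (w_in_W : W w) :
  let wavg := fun omega => weighted_average alpha n (fun m => it m omega) in
  let excess_loss := fun omega : Omega =>
    loss rho (vec (Z 0%N omega).1) (Z 0%N omega).2 (wavg omega) -
    loss rho (vec (Z 0%N omega).1) (Z 0%N omega).2 w in
  let bound := (U ^+ 2 + G ^+ 2 / 2 * \sum_(1 <= m < n.+1) alpha m ^+ 2) /
    \sum_(1 <= m < n.+1) alpha m in
  [/\ Pr.-integrable [set: Omega] (EFin \o excess_loss),
      ('E_Pr[excess_loss] <= bound%:E)%E,
      Pr.-integrable [set: Omega] (risk P rho \o wavg)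
    & ((\int[Pr]_omega risk P rho (wavg omega)) - risk P rho w <= bound%:E)%E].
Proof.
move=> wavg excess bound.
case: n n_gt0 => [//|p] _ in alpha_gt0 Z_iid it_run wavg excess bound *.
pose T := (instance X0 * class k_gt1)%type.
pose Zi (i : 'I_p.+2) : {RV Pr >-> T} := Z i.
(* [J m] holds the indices 1, ..., m - 1 of the data that determine [it m]; index 0, the test pair,
   is always left out. *)
pose J m := [set i : 'I_p.+2 | (0 < i < m)%N]%SET.
pose F m := g_sigma_algebraType (past Zi (J m)).
pose l (z : T) (v : 'M[R]_(d, k)) := loss rho (vec z.1) z.2 v.
have itW omega m : (1 <= m <= p.+1)%N -> W (it m omega).
  have [m1 ms] := it_run omega; case: m => [//|[_|m mp]]; first by case: m1.
  by have [] := ms m.+1 mp.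
have avgW omega : W (wavg omega).
  exact: (convex_set_weighted_average W_convex alpha_gt0 (fun m => itW omega m)).
(* The selection [g] is measurable only over [W], so it is composed with maps valued in [W], a
   closed and hence Borel set. *)
have mg (dS : measure_display) (S : measurableType dS) (z : S -> T) v :
    measurable_fun setT z -> measurable_fun setT v -> (forall s, W (v s)) ->
    measurable_fun setT (fun s => g (z s) (v s)).
  move=> mz mv Wv; apply: (@measurable_comp _ _ _ _ _ _ [set q : T * 'M[R]_(d, k) | W q.2]
    (fun q => g q.1 q.2) setT (fun s => (z s, v s))) => //.
  - rewrite -[X in measurable X]setTI; apply: measurable_snd => //.
    exact: closed_measurable_mx.
  - by move=> _ [s _ <-]; exact: Wv.
  - exact: measurable_fun_pair.
have ml (dS : measure_display) (S : measurableType dS) (z : S -> T) v :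
    measurable_fun setT z -> measurable_fun setT v ->
    measurable_fun setT (fun s => l (z s) (v s)).
  move=> mz mv; apply: measurable_loss => //.
    exact: measurableT_comp measurable_fst mz.
  exact: measurableT_comp measurable_snd mz.
(* The first iterate minimises for the constant parameter 0; each later one is built from [it m] and
   [Z m], both measurable for [F m.+1]. *)
have mit m : (1 <= m <= p.+1)%N -> measurable_fun setT (it m : F m -> 'M[R]_(d, k)).
  case: m => [//|m]; elim: m => [_|m IH mp].
    apply: (@measurable_argmin _ _ _ _ N_norm _ _ W_convex psi_differentiable
      psi_strongly_convex _ _ (fun=> 0)) => // omega.
    have [[W1 m1] _] := it_run omega; split=> // u /m1.
    by rewrite !(innerC 0) !inner0r !subr0.
  have mp' : (m.+1 < p.+2)%N by rewrite ltnW.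
  have JJ : (J m.+1 \subset J m.+2)%SET.
    by apply/fintype.subsetP => i; rewrite !inE => /andP[-> /= im]; exact: ltnW.
  have mitm : measurable_fun setT (it m.+1 : F m.+2 -> 'M[R]_(d, k)).
    by apply: (measurable_sub_past JJ); apply: IH; rewrite /= ltnW.
  have mZm : measurable_fun setT (Z m.+1 : F m.+2 -> T).
    have /measurable_past : Ordinal mp' \in J m.+2 by rewrite inE/=.
    exact.
  have itWm (omega : F m.+2) : W (it m.+1 omega) by apply: itW; rewrite /= ltnW.
  apply: (measurable_mirror_step N_norm W_convex psi_differentiable
    psi_strongly_convex grad_psi_continuous (mg _ _ _ _ mZm mitm itWm) mitm itWm) => omega.
  by have [_] := it_run omega; apply.
have mitO m : (1 <= m <= p.+1)%N -> measurable_fun setT (it m).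
  by move=> mp; apply: measurable_sub_sigma_algebra (mit m mp); exact: past_measurable.
have mavg : measurable_fun setT (wavg : F p.+2 -> 'M[R]_(d, k)).
  apply: measurable_mxP => i j; under eq_fun do rewrite !mxE.
  apply: measurable_funM => //; under eq_fun do rewrite summxE big_add1 big_mkord.
  apply: measurable_sum => m; under eq_fun do rewrite mxE.
  apply: measurable_funM => //; apply: measurable_entry.
  have mm : (1 <= m.+1 <= p.+1)%N := ltn_ord m.
  apply: measurable_sub_past (mit _ mm).
  apply/fintype.subsetP => q; rewrite !inE => /andP[-> /= qm].
  by rewrite (leq_trans qm)// ltnW// ltnS.
have mavgO : measurable_fun setT wavg.
  by apply: measurable_sub_sigma_algebra mavg; exact: past_measurable.
(* [Z i] can be integrated out given [F m] unless [i] is among 1, ..., m - 1. This covers the next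
   observation, [i = m], and the test pair, [i = 0]. *)
have freeze (i : nat) m (f : F m * T -> \bar R) : (i < p.+2)%N -> ~~ (0 < i < m)%N ->
    measurable_fun setT f -> (forall q, (0 <= f q)%E) ->
    measurable_fun setT (fun omega : Omega => \int[P]_t f (omega, t))%E /\
    (\int[Pr]_omega f (omega, Z i omega) = \int[Pr]_omega \int[P]_t f (omega, t))%E.
  move=> ip im mf f0.
  apply: (@ge0_integral_freezing _ _ _ _ _ Pr P (past Zi (J m)) (Z i)) => //.
  - exact: past_measurable.
  - exact: pastT.
  - exact: pastI.
  - move=> B A pB mA; apply: (past_independent (i := Ordinal ip) Z_iid _ pB mA).
    by rewrite inE.
have freeze_loss (i : nat) m (v : Omega -> 'M[R]_(d, k)) :
    (i < p.+2)%N -> ~~ (0 < i < m)%N -> measurable_fun setT (v : F m -> 'M[R]_(d, k)) ->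
    measurable_fun setT (risk P rho \o v) /\
    (\int[Pr]_omega (l (Z i omega) (v omega))%:E = \int[Pr]_omega risk P rho (v omega))%E.
  move=> ip im mv.
  apply: (freeze i m (fun q => (l q.2 (v q.1))%:E)) => //.
    apply/measurable_EFinP; apply: ml; first exact: measurable_snd.
    exact: measurableT_comp mv measurable_fst.
  by move=> q; rewrite lee_fin loss_ge0.
have sumE (V : nmodType) (f : nat -> V) :
    \sum_(1 <= m < p.+2) f m = \sum_(m < p.+1) f m.+1 by rewrite big_add1 big_mkord.
have ordP (m : 'I_p.+1) : (1 <= m.+1 <= p.+1)%N := ltn_ord m.
have ordP' (m : 'I_p.+1) : (m.+1 < p.+2)%N := ltn_ord m.
have a0 (m : 'I_p.+1) : 0 <= alpha m.+1 by rewrite ltW// alpha_gt0.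
pose a := \sum_(m < p.+1) alpha m.+1.
have agt0 : 0 < a by rewrite /a -sumE; exact: sum_weights_gt0.
pose gnorm (m : 'I_p.+1) omega := dual_norm N (g (Z m.+1 omega) (it m.+1 omega)) ^+ 2.
have gnorm0 m omega : 0 <= gnorm m omega by exact: sqr_ge0.
have c0 (m : 'I_p.+1) : 0 <= 2^-1 * alpha m.+1 ^+ 2 by rewrite mulr_ge0 ?invr_ge0 ?sqr_ge0.
have mgnorm m : measurable_fun setT (gnorm m).
  apply: measurable_funX; apply: measurable_dual_norm => //.
  apply: mg => [|| omega]; [exact: measurable_funPT|exact: mitO|exact: itW].
(* Once the fresh observation is integrated out, the inner integral is at most [G ^+ 2] at every
   value of the iterate. *)
have Egnorm m : (\int[Pr]_omega (gnorm m omega)%:E <= (G ^+ 2)%:E)%E.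
  have mf : measurable_fun setT
      (fun q : F m.+1 * T => (dual_norm N (g q.2 (it m.+1 q.1)) ^+ 2)%:E).
    apply/measurable_EFinP; apply: measurable_funX; apply: measurable_dual_norm => //.
    apply: mg => [||q]; [exact: measurable_snd| |exact: itW].
    exact: measurableT_comp (mit _ (ordP m)) measurable_fst.
  have [||mI ->] := freeze m.+1 m.+1 _ (ordP' m) _ mf.
  - by rewrite ltnn andbF.
  - by move=> q; rewrite lee_fin sqr_ge0.
  rewrite -[leRHS]mule1 -(probability_setT Pr) -integral_cst//.
  apply: ge0_le_integral => //.
    by move=> omega _; apply: integral_ge0 => t _; rewrite lee_fin sqr_ge0.
  move=> omega _; rewrite /cst G_def; apply: ereal_sup_ubound.
  by exists (it m.+1 omega) => //; exact: itW.
have Fw := fineK (risk_finite w w_in_W); set Fw' := fine _ in Fw.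
have Elw (i : nat) : (i < p.+2)%N -> (\int[Pr]_omega (l (Z i omega) w)%:E = Fw'%:E)%E.
  (* With [m = 0] the past is empty, and the constant [w] is measurable for it. *)
  move=> ip; have [||_ ->] := freeze_loss i 0%N (cst w) ip.
  - by rewrite ltn0 andbF.
  - by [].
  by rewrite /= -Fw integral_cst// [X in (_ * X)%E]probability_setT mule1.
have mlw (i : nat) : measurable_fun setT (fun omega => l (Z i omega) w).
  by apply: ml => //; exact: measurable_funPT.
have mlit (i : nat) (m : 'I_p.+1) :
    measurable_fun setT (fun omega => l (Z i omega) (it m.+1 omega)).
  by apply: ml; [exact: measurable_funPT|exact: mitO].
pose E0 := (\int[Pr]_omega (l (Z 0%N omega) (wavg omega))%:E)%E.
have [mrisk E0E] := freeze_loss 0%N p.+2 wavg isT isT mavg.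
have upper : (\sum_(m < p.+1) (alpha m.+1)%:E *
      \int[Pr]_omega (l (Z m.+1 omega) (it m.+1 omega))%:E <=
    (a * Fw' + (U ^+ 2 + 2^-1 * \sum_(m < p.+1) alpha m.+1 ^+ 2 * G ^+ 2))%:E)%E.
  rewrite -ge0_integral_weighted_sum//; last by move=> m omega; exact: loss_ge0.
  apply: (@le_trans _ _ (\int[Pr]_omega ((\sum_(m < p.+1) alpha m.+1 * l (Z m.+1 omega) w)%:E +
      ((U ^+ 2)%:E + (\sum_(m < p.+1) (2^-1 * alpha m.+1 ^+ 2) * gnorm m omega)%:E)))%E).
    apply: ge0_le_integral => //.
    - by move=> omega _; rewrite lee_fin sumr_ge0// => m _; rewrite mulr_ge0// loss_ge0.
    - by apply/measurable_EFinP; apply: measurable_sum => m; exact: measurable_funM.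
    - apply/measurable_EFinP; apply: measurable_funD.
        by apply: measurable_sum => m; exact: measurable_funM.
      apply: measurable_funD => //.
      by apply: measurable_sum => m; exact: measurable_funM.
    (* For each sample, the regret bound is combined with the subgradient inequalities at the
       iterates. *)
    move=> omega _; rewrite -!EFinD lee_fin.
    have [m1 ms] := it_run omega.
    have psiU : psi w - psi (it 1%N omega) <= U ^+ 2.
      rewrite -lee_fin U_def; apply: ereal_sup_ubound.
      by exists w => //; exists (it 1%N omega) => //; exact: itW.
    have := mirror_descent_regret N_norm W_convex psi_differentiable psi_strongly_convex
      (g := fun m => g (Z m omega) (it m omega)) alpha_gt0 m1 ms w_in_W.
    rewrite !sumE mulr_sumr.
    under [X in _ <= _ + X]eq_bigr do rewrite mulrA.
    have : \sum_(m < p.+1) alpha m.+1 * l (Z m.+1 omega) (it m.+1 omega) <=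
        \sum_(m < p.+1) alpha m.+1 * l (Z m.+1 omega) w +
        \sum_(m < p.+1) alpha m.+1 *
          inner (g (Z m.+1 omega) (it m.+1 omega)) (it m.+1 omega - w).
      rewrite -big_split/=; apply: ler_sum => m _; rewrite -mulrDr ler_wpM2l//.
      have := g_subgradient (Z m.+1 omega) _ (itW omega _ (ordP m)) w.
      rewrite -[w - _]opprB innerNr /l; lra.
    rewrite /gnorm; lra.
  rewrite ge0_integralD//; last 4 first.
  - by move=> omega _; rewrite lee_fin sumr_ge0// => m _; rewrite mulr_ge0// loss_ge0.
  - by apply/measurable_EFinP; apply: measurable_sum => m; exact: measurable_funM.
  - move=> omega _; rewrite -EFinD lee_fin addr_ge0 ?sqr_ge0//.
    by apply: sumr_ge0 => m _; rewrite mulr_ge0.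
  - apply/measurable_EFinP; apply: measurable_funD => //.
    by apply: measurable_sum => m; exact: measurable_funM.
  rewrite ge0_integralD//; last 3 first.
  - by move=> omega _; rewrite lee_fin sqr_ge0.
  - by move=> omega _; rewrite lee_fin sumr_ge0// => m _; rewrite mulr_ge0.
  - apply/measurable_EFinP.
    by apply: measurable_sum => m; exact: measurable_funM.
  rewrite !ge0_integral_weighted_sum//; last by move=> m omega; exact: loss_ge0.
  rewrite integral_cst// [X in (_ * X)%E]probability_setT mule1 !EFinD leeD//.
    rewrite /a mulr_suml -sumEFin; apply: lee_sum => m _.
    by rewrite Elw// EFinM.
  rewrite leeD2l// mulr_sumr -sumEFin; apply: lee_sum => m _.
  rewrite [X in (_ <= X%:E)%E]mulrA [leRHS]EFinM.
  by apply: lee_wpmul2l; [rewrite lee_fin|exact: Egnorm].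
have lower : (a%:E * E0 <= \sum_(m < p.+1) (alpha m.+1)%:E *
      \int[Pr]_omega (l (Z m.+1 omega) (it m.+1 omega))%:E)%E.
  (* [Z m.+1] and [Z 0] are both independent of the past that fixes [it m.+1], so both integrals
     equal the expected risk of that iterate. All losses are then on the same test pair, and
     Jensen's inequality applies pointwise. *)
  have swap (m : 'I_p.+1) : (\int[Pr]_omega (l (Z m.+1 omega) (it m.+1 omega))%:E =
      \int[Pr]_omega (l (Z 0%N omega) (it m.+1 omega))%:E)%E.
    have mm : ~~ (0 < m.+1 < m.+1)%N by rewrite ltnn andbF.
    have [_ em] := freeze_loss m.+1 m.+1 _ (ordP' m) mm (mit _ (ordP m)).
    have [_ e0] := freeze_loss 0%N m.+1 _ isT isT (mit _ (ordP m)).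
    exact: etrans em (esym e0).
  rewrite (eq_bigr _ (fun (m : 'I_p.+1) _ => congr1 (mule (alpha m.+1)%:E) (swap m))).
  rewrite -ge0_integral_weighted_sum//; last by move=> m omega; exact: loss_ge0.
  rewrite -ge0_integralZl//; last 3 first.
  - by apply/measurable_EFinP; apply: ml => //; exact: measurable_funPT.
  - by move=> omega _; rewrite lee_fin loss_ge0.
  - by rewrite lee_fin ltW.
  apply: ge0_le_integral => //.
  - by move=> omega _; rewrite -EFinM lee_fin mulr_ge0 ?loss_ge0// ltW.
  - apply/measurable_EFinP; apply: measurable_funM => //.
    by apply: ml => //; exact: measurable_funPT.
  - by apply/measurable_EFinP; apply: measurable_sum => m; exact: measurable_funM.
  move=> omega _; rewrite -EFinM lee_fin.
  have := subgradient_weighted_average alpha_gt0 (g_subgradient (Z 0%N omega) _ (avgW omega)).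
  by rewrite !sumE.
have E0_le : (E0 <= (Fw' + bound)%:E)%E.
  rewrite -(@lee_pmul2l _ a%:E) ?lte_fin//.
  apply: le_trans lower (le_trans upper _).
  rewrite -EFinM lee_fin mulrDr lerD2l /bound !sumE -/a [leRHS]mulrC divfK ?gt_eqF//.
  by rewrite -mulr_suml lerD2l; lra.
(* Nonnegativity and the bound just obtained make [E0] finite, which yields both integrability
   claims and permits the subtraction of the loss at [w]. *)
have E0_ge0 : (0 <= E0)%E by apply: integral_ge0 => omega _; rewrite lee_fin loss_ge0.
have E0_fin : E0 \is a fin_num.
  by rewrite ge0_fin_numE// (le_lt_trans E0_le)// ltry.
have iavg : Pr.-integrable setT (EFin \o (fun omega => l (Z 0%N omega) (wavg omega))).
  apply/integrableP; split.
    by apply/measurable_EFinP; apply: ml => //; exact: measurable_funPT.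
  under eq_integral do rewrite gee0_abs ?lee_fin ?loss_ge0//.
  by rewrite ltey_eq E0_fin.
have iw : Pr.-integrable setT (EFin \o (fun omega => l (Z 0%N omega) w)).
  apply/integrableP; split; first by apply/measurable_EFinP; exact: mlw.
  under eq_integral do rewrite gee0_abs ?lee_fin ?loss_ge0//.
  by rewrite /= Elw// ltry.
have risk_ge0 v : (0 <= risk P rho v)%E.
  by apply: integral_ge0 => z _; rewrite lee_fin loss_ge0.
split.
- exact: (integrableB measurableT iavg iw).
- rewrite unlock /excess; under eq_integral do rewrite EFinB.
  by rewrite integralB_EFin// Elw// leeBlDr// -EFinD addrC.
- apply/integrableP; split => //.
  under eq_integral do rewrite gee0_abs ?risk_ge0//.
  by rewrite /= -E0E -/E0 (le_lt_trans E0_le)// ltry.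
- by rewrite -E0E -Fw leeBlDr// -EFinD addrC.
Qed.
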